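(* Let $k\geq 1$ and $s\geq 3$ be integers. The $s$-stable Kneser graph $K_{s\text{-stab}}(n,k)$ is Hamiltonian if and only if $n\geq sk$. Moreover, for $k\geq 1$, the graph $K_{2\text{-stab}}(n,k)$ is Hamiltonian if and only if $n\geq 2k+1$.
   Context: For positive integers $n,k,s$, write $[n]=\{1,\dots,n\}$. The $s$-stable Kneser graph $K_{s\text{-stab}}(n,k)$ has as vertex set all $k$-element subsets $S\subseteq[n]$ such that $s\leq |i-j|\leq n-s$ for every pair of distinct elements $i,j\in S$ (i.e. any two elements of $S$ are at cyclic distance at least $s$ modulo $n$), and two vertices are adjacent if and only if they are disjoint sets. (For $s=2$ this is the Schrijver graph $SG(n,k)$.) A graph is Hamiltonian if it contains a cycle passing through every vertex exactly once.
   Formalization: For s ≥ 3, the cases k = 1 with 3 ≤ n < s are excluded: there stability is vacuous and the graph is the complete graph K_n, which is Hamiltonian although n < sk, so the equivalence fails. *)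

(* Defs.v *)
From mathcomp Require Import all_boot ssrint.
Set Implicit Arguments.
Unset Strict Implicit.
Unset Printing Implicit Defensive.

(* ['I_n] stands for [n] = {1, ..., n}: only differences of elements matter, so
   starting at 0 is harmless.  The truncation in [n - s] has no effect when
   [0 < s], since [s <= `|i - j| <= n - s] then forces [s < n]. *)
Definition stable (s n : nat) (S : {set 'I_n}) : bool :=
  [forall i in S, forall j in S, (i != j) ==> (s <= `|i - j| <= n - s)%N].

Definition stable_kneser_vertex (s n k : nat) : finType :=
  {S : {set 'I_n} | (#|S| == k) && stable s S}.

Definition stable_kneser (s n k : nat) : rel (stable_kneser_vertex s n k) :=
  fun A B => [disjoint val A & val B].
Arguments stable_kneser s n k : clear implicits.

(* [cycle] accepts sequences of length at most 2, which are not cycles of a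
   graph; hence the lower bound on the size. *)
Definition hamiltonian (V : finType) (adj : rel V) : Prop :=
  exists c : seq V,
    [/\ (3 <= size c)%N, cycle adj c, uniq c & forall v : V, v \in c].

(* Main.v *)
(** If [S] is stable then [S] and [S + 1] are disjoint, so the orbits of the rotation
    [S |-> S + 1] partition the graph into cycles.  If moreover [0 \in S] and [S'] is
    obtained from [S + 1] by replacing [1] by [2], then [S], [S + 1], [S' + 1], [S'] is
    a 4-cycle, and exchanging its edges merges the two orbits of [S] and [S'].  These
    4-cycles use up pairwise disjoint edges of the orbits: [S] contains [0], while
    [S'] contains [2] but not [0].  Hence the merges do not interfere, and a Hamilton
    cycle exists as soon as they connect all orbits.  They do: a vertex of minimal
    element sum in a class closed under rotation and merging is
    [{0, s, 2s, ..., (k-1)s}]. *)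

Require Import Defs.
From mathcomp Require Import all_boot ssrint.
From mathcomp Require Import zify.
Set Implicit Arguments.
Unset Strict Implicit.
Unset Printing Implicit Defensive.

(** * Successors on cyclic sequences *)

Lemma next_catl (T : eqType) (c1 c2 : seq T) (x0 z : T) :
  uniq (c1 ++ c2) -> z \in c1 -> z != last x0 c1 ->
  next (c1 ++ c2) z = next c1 z.
Proof.
case: c1 => [//|a p] Uc zc nz; rewrite !next_nth mem_cat zc /=.
have [->|az] := eqVneq a z.
  by case: p zc nz {Uc} => [|b p] //=; rewrite inE => /eqP ->; rewrite eqxx.
rewrite ?(negPf az) /=.
have zp : z \in p by move: zc; rewrite inE eq_sym (negPf az).
rewrite index_cat zp nth_cat; case: ltnP => // lez.
case/negP: nz; move: Uc; rewrite /= cat_uniq => /and3P[_ Up _].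
have ltz : index z p < size p by rewrite index_mem.
rewrite -[X in X == _](nth_index a zp) (last_nth a) /=.
suff -> : size p = (index z p).+1 by [].
by apply/eqP; rewrite eqn_leq lez ltz.
Qed.

Lemma next_catr (T : eqType) (c1 c2 : seq T) (x0 z : T) :
  uniq (c1 ++ c2) -> z \in c2 -> z != last x0 c2 ->
  next (c1 ++ c2) z = next c2 z.
Proof.
move=> Uc zc nz; rewrite -(next_rot (size c1)) // rot_size_cat.
by apply: (next_catl (x0 := x0)) => //; rewrite uniq_catC.
Qed.

(** Symmetric in [x] and [y], so that the notion survives reversing the cycle. *)
Definition consecutive (T : eqType) (c : seq T) (x y : T) : bool :=
  (next c x == y) || (next c y == x).

Lemma consecutive_rot (T : eqType) (n : nat) (c : seq T) (x y : T) :
  uniq c -> consecutive (rot n c) x y = consecutive c x y.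
Proof. by move=> Uc; rewrite /consecutive !next_rot. Qed.

Lemma consecutive_rev (T : eqType) (c : seq T) (x y : T) :
  uniq c -> consecutive (rev c) x y = consecutive c x y.
Proof.
move=> Uc; rewrite /consecutive !next_rev // orbC.
congr (_ || _); apply/eqP/eqP => <-; first by rewrite next_prev.
- by rewrite prev_next.
- by rewrite next_prev.
by rewrite prev_next.
Qed.

(** Cutting the cycle at the edge between [a] and [b] leaves a path from [b] to [a]; a reversal is
    needed when [a] follows [b]. *)
Lemma consecutive_orient (T : eqType) (c : seq T) (a b : T) :
  uniq c -> b \in c -> consecutive c a b ->
  exists p, last b p = a /\
    exists n, b :: p = rot n c \/ b :: p = rot n (rev c).
Proof.
have step d : uniq d -> b \in d -> next d a = b ->
    exists p, last b p = a /\ exists n, b :: p = rot n d.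
  move=> Ud bd nab; have [i p Ep] := rot_to bd.
  exists p; split; last by exists i.
  have : next (b :: p) (last b p) = b.
    have Ubp : uniq (b :: p) by rewrite -Ep rot_uniq.
    by have := cycle_next Ubp; rewrite [cycle _ _]rcons_path => /andP[_ /eqP].
  rewrite -Ep !next_rot // -[in RHS]nab => E.
  exact: (can_inj (prev_next Ud)).
move=> Uc bc /orP[/eqP|/eqP] nab.
  have [p [Ep [n En]]] := step c Uc bc nab.
  by exists p; split; last by exists n; left.
have [|||p [Ep [n En]]] := step (rev c).
- by rewrite rev_uniq.
- by rewrite mem_rev.
- by rewrite next_rev // -nab prev_next.
by exists p; split=> //; exists n; right.
Qed.

(** * Gluing the orbits of an injection along 4-cycles *)

Section Glue.
Variables (V : finType) (adj : rel V) (f : V -> V) (N : rel V).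
Hypothesis (f_inj : injective f) (adj_sym : symmetric adj).
Hypothesis (adj_f : forall x, adj x (f x)) (ff_neq : forall x, f (f x) != x).
(** [N x y] stands for the 4-cycle [x], [f x], [f y], [y]. By [N_fun] the edge from [x] to [f x] is
    claimed by at most one of them. [conn] is connectedness of the orbits joined by [N], phrased
    through closed sets. *)
Hypothesis (N_sym : symmetric N).
Hypothesis (N_fun : forall x y z, N x y -> N x z -> y = z).
Hypothesis (N_adj : forall x y, N x y -> adj x y && adj (f x) (f y)).
Hypothesis (conn : forall W : pred V, (exists x, W x) ->
  (forall x, W (f x) = W x) -> (forall x y, N x y -> W x = W y) ->
  forall x, W x).

(* An edge {x, f x} is still available on [c] as long as the 4-cycle attached to
   x by [N] has not been used. *)
Definition partial_cycle (c : seq V) : Prop :=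
  [/\ uniq c, cycle adj c, forall x, (f x \in c) = (x \in c) &
      forall x, x \in c -> (forall y, N x y -> y \notin c) ->
        consecutive c x (f x)].

Lemma partial_cycle_rot n c : partial_cycle c -> partial_cycle (rot n c).
Proof.
move=> [Uc Cc Fc Nc]; split; first by rewrite rot_uniq.
- by rewrite rot_cycle.
- by move=> x; rewrite !mem_rot.
- move=> x; rewrite mem_rot consecutive_rot // => xc Nx; apply: Nc => // y.
  by move/Nx; rewrite mem_rot.
Qed.

Lemma partial_cycle_rev c : partial_cycle c -> partial_cycle (rev c).
Proof.
move=> [Uc Cc Fc Nc]; split; first by rewrite rev_uniq.
- by rewrite rev_cycle (eq_cycle (e' := adj)).
- by move=> x; rewrite !mem_rev.
- move=> x; rewrite mem_rev consecutive_rev // => xc Nx; apply: Nc => // y.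
  by move/Nx; rewrite mem_rev.
Qed.

Lemma partial_cycle_orbit x : partial_cycle (orbit f x).
Proof.
have C := cycle_orbit f_inj x; split; first exact: orbit_uniq.
- by apply: sub_cycle C => u v /eqP <-.
- by move=> y; rewrite -!fconnect_orbit -(same_fconnect1_r f_inj).
- by move=> y yo _; rewrite /consecutive (nextE C) ?eqxx.
Qed.

Lemma partial_cycle_orient c a b : partial_cycle c -> b \in c ->
  consecutive c a b ->
  exists p, [/\ last b p = a, partial_cycle (b :: p) & perm_eq (b :: p) c].
Proof.
move=> Pc bc ab; have [Uc _ _ _] := Pc.
have [p [Ep [n En]]] := consecutive_orient Uc bc ab; exists p.
case: En => En; split; rewrite // En ?perm_rot ?perm_rev //.
- exact: partial_cycle_rot.
- exact/partial_cycle_rot/partial_cycle_rev.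
Qed.

(** Read [c1] from [f x] to [x] and [c2] from [y] to [f y]; concatenation then closes up through the
    edges from [x] to [y] and from [f y] to [f x]. The two edges lost are those of [x] and [y],
    which are exempt from now on because their 4-cycle has been used. *)
Lemma partial_cycle_cat c1 c2 x y :
  partial_cycle c1 -> partial_cycle c2 -> uniq (c1 ++ c2) ->
  x \in c1 -> y \in c2 -> N x y -> exists c,
    partial_cycle c /\ c =i c1 ++ c2.
Proof.
wlog [p [Ep Ec1]] : c1 / exists p, last (f x) p = x /\ c1 = f x :: p.
  move=> IH P1 P2 U12 x1 y2 Nxy; have [U1 C1 F1 N1] := P1.
  have fx1 : f x \in c1 by rewrite F1.
  (* The only partner of [x] is [y], which lies outside [c1], so the edge of [x] is still
     available. *)
  have cons1 : consecutive c1 x (f x).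
    apply: N1 => // z /(N_fun Nxy) <-.
    by move: U12; rewrite cat_uniq => /and3P[_ /hasPn/(_ y y2)].
  have [p [Ep Pp Mp]] := partial_cycle_orient P1 fx1 cons1.
  have Pcat : perm_eq ((f x :: p) ++ c2) (c1 ++ c2) by rewrite perm_cat2r.
  have U' : uniq ((f x :: p) ++ c2) by rewrite (perm_uniq Pcat).
  have x1' : x \in f x :: p by rewrite (perm_mem Mp).
  have [c [Pc Ec]] := IH _ (ex_intro _ p (conj Ep erefl)) Pp P2 U' x1' y2 Nxy.
  by exists c; split=> // z; rewrite Ec (perm_mem Pcat).
wlog [q [Eq Ec2]] : c2 / exists q, last y q = f y /\ c2 = y :: q.
  move=> IH P1 P2 U12 x1 y2 Nxy; have [U2 C2 F2 N2] := P2.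
  have cons2 : consecutive c2 (f y) y.
    rewrite /consecutive orbC; apply: N2 => // z Nyz.
    have -> : z = x by apply: N_fun Nyz _; rewrite N_sym.
    move: U12; rewrite cat_uniq => /and3P[_ /hasPn H _].
    by apply: contraL x1; apply: H.
  have [q [Eq Pp Mp]] := partial_cycle_orient P2 y2 cons2.
  have Pcat : perm_eq (c1 ++ (y :: q)) (c1 ++ c2) by rewrite perm_cat2l.
  have U' : uniq (c1 ++ (y :: q)) by rewrite (perm_uniq Pcat).
  have [c [Pc Ec]] :=
    IH _ (ex_intro _ q (conj Eq erefl)) P1 Pp U' x1 (mem_head y q) Nxy.
  by exists c; split=> // z; rewrite Ec (perm_mem Pcat).
move=> [U1 C1 F1 N1] [U2 C2 F2 N2] U12 x1 y2 Nxy.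
have /andP[axy afxy] := N_adj Nxy.
have nx : next c1 x = f x.
  rewrite -[in next _ _]Ep; have := cycle_next U1; rewrite Ec1 /= rcons_path.
  by case/andP=> _ /eqP.
have ny : next c2 (f y) = y.
  rewrite -[in next _ _]Eq; have := cycle_next U2; rewrite Ec2 /= rcons_path.
  by case/andP=> _ /eqP.
have L1 : last x c1 = x by rewrite Ec1.
have L2 : last x c2 = f y by rewrite Ec2.
exists (c1 ++ c2); split=> //; split=> //.
- move: C1 C2; rewrite Ec1 Ec2 /= !rcons_path cat_path last_cat /= Ep Eq.
  by case/andP=> -> _ /andP[-> _]; rewrite axy adj_sym afxy.
- by move=> z; rewrite !mem_cat F1 F2.
move=> z; rewrite mem_cat => /orP[z1|z2] Nz.
- have zx : z != x.
    apply: contraTneq y2 => zx; have := Nz y; rewrite zx mem_cat negb_or.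
    by move=> /(_ Nxy)/andP[].
  have /orP[/eqP E|/eqP E] : consecutive c1 z (f z).
  + by apply: N1 => // t /Nz; rewrite mem_cat negb_or => /andP[].
  + by rewrite /consecutive (next_catl (x0 := x)) ?L1 // E eqxx.
  + rewrite /consecutive [in X in _ || X](next_catl (x0 := x)) ?L1 ?F1 ?E
      ?eqxx ?orbT //.
    (* Only the successor of the last entry [x] changes. If [f z] were [x], then [z], following it
       on [c1], would be [f x], and [f (f x)] would be [x]. *)
    apply: contraNneq (ff_neq x) => fzx; rewrite fzx nx in E.
    by rewrite E fzx.
- have zy : z != y.
    apply: contraTneq x1 => zy; have := Nz x; rewrite zy N_sym mem_cat negb_or.
    by move=> /(_ Nxy)/andP[].
  have /orP[/eqP E|/eqP E] : consecutive c2 z (f z).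
  + by apply: N2 => // t /Nz; rewrite mem_cat negb_or => /andP[].
  + rewrite /consecutive (next_catr (x0 := x)) ?L2 ?E ?eqxx //.
    apply: contraNneq (ff_neq y) => zfy; rewrite zfy ny in E.
    by rewrite -E.
  + rewrite /consecutive [in X in _ || X](next_catr (x0 := x)) ?L2 ?F2 ?E
      ?eqxx ?orbT //.
    by rewrite (inj_eq f_inj).
Qed.

(** Since [c] is closed under [f] but is not everything, [conn] yields a pair in [N] with one end on
    [c] and the other off it; the orbit of the latter is glued on. *)
Lemma partial_cycle_extend c v w : partial_cycle c -> v \in c -> w \notin c ->
  exists c', (partial_cycle c' /\ {subset c <= c'}) /\ size c < size c'.
Proof.
move=> Pc vc wc; have [Uc _ Fc _] := Pc.
case: (pickP [pred t : V * V | [&& N t.1 t.2, t.1 \in c & t.2 \notin c]]); last first.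
  move=> noN; case/negP: wc; apply: (conn (W := [in c])).
  - by exists v.
  - by move=> x; rewrite /= Fc.
  - move=> x y Nxy /=; apply/idP/idP => [xc|yc]; apply/negPn/negP => nc.
    + by have := noN (x, y); rewrite /= Nxy xc nc.
    + by have := noN (y, x); rewrite /= N_sym Nxy yc nc.
case=> x y /= /and3P[Nxy xc yc].
have U : uniq (c ++ orbit f y).
  rewrite cat_uniq Uc orbit_uniq andbT /=; apply/hasPn => z.
  rewrite -fconnect_orbit => /iter_findex <-.
  by elim: (findex _ _ _) => //= n IH; rewrite Fc.
have [c' [Pc' Ec']] :=
  partial_cycle_cat Pc (partial_cycle_orbit y) U xc (in_orbit f y) Nxy.
exists c'; split; first by split=> // z zc; rewrite Ec' mem_cat zc.
case: Pc' => Uc' _ _ _.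
rewrite (perm_size (uniq_perm Uc' U Ec')) size_cat size_orbit.
by rewrite -[ltnLHS]addn0 ltn_add2l order_gt0.
Qed.

Lemma hamiltonian_of_rotation (v : V) : hamiltonian adj.
Proof.
have [c [Pc fullc]] : exists c, partial_cycle c /\ forall w, w \in c.
  have : exists c, partial_cycle c /\ v \in c.
    by exists (orbit f v); split; [exact: partial_cycle_orbit | exact: in_orbit].
  case=> c [Pc vc]; move: {2}(#|V| - size c) (leqnn (#|V| - size c)) => m.
  elim: m c Pc vc => [|m IH] c Pc vc lem.
    exists c; split=> // w; apply/negPn/negP => wc.
    have [c' [[[Uc' _ _ _] _] lt]] := partial_cycle_extend Pc vc wc.
    have := max_card [in c']; rewrite (card_uniqP Uc'); lia.
  case: (pickP [pred w | w \notin c]) => [w wc|full]; last first.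
    by exists c; split=> // w; have /negbFE := full w.
  have [c' [[Pc' sub] lt]] := partial_cycle_extend Pc vc wc.
  by apply: (IH c' Pc' (sub v vc)); lia.
exists c; have [Uc Cc _ _] := Pc; split=> //.
(* Every orbit has at least three elements, whence the length required of a Hamilton cycle. *)
have U3 : uniq [:: v; f v; f (f v)].
  have fv : v != f v by apply: contraNneq (ff_neq v) => E; rewrite -!E.
  by rewrite /= !inE negb_or fv (inj_eq f_inj) fv eq_sym ff_neq.
by apply: (uniq_leq_size U3) => w _.
Qed.

End Glue.

(** * Stable sets and the successor modulo n *)

Lemma val_ordS n (i : 'I_n) : ordS i = (if i.+1 == n then 0 else i.+1) :> nat.
Proof.
rewrite /=; case: eqP => [->|ne]; first by rewrite modnn.
by rewrite modn_small //; have := ltn_ord i; lia.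
Qed.

(** Ordered pairs and sums in place of absolute values and differences make stability accessible to
    [lia]. *)
Lemma stableP s n (S : {set 'I_n}) :
  reflect (forall i j : 'I_n, i \in S -> j \in S -> i < j ->
             i + s <= j /\ j + s <= i + n) (stable s S).
Proof.
apply: (iffP idP) => [/forallP H i j iS jS ij|H].
  have nij : i != j by rewrite -val_eqE /= neq_ltn ij.
  have /implyP/(_ iS)/forallP/(_ j)/implyP/(_ jS)/implyP/(_ nij) := H i.
  have := ltn_ord j; lia.
apply/forallP => i; apply/implyP => iS; apply/forallP => j; apply/implyP => jS.
apply/implyP; rewrite -val_eqE /= => nij.
have H1 := H i j iS jS; have H2 := H j i jS iS.
have := ltn_ord j; have := ltn_ord i; lia.
Qed.

Lemma stable_rotate s n (S : {set 'I_n}) : stable s S -> stable s (@ordS _ @: S).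
Proof.
move=> /stableP H; apply/stableP => _ _ /imsetP[i iS ->] /imsetP[j jS ->].
rewrite !val_ordS; have H1 := H i j iS jS; have H2 := H j i jS iS.
by have := ltn_ord j; have := ltn_ord i; do 2!case: eqP => ?; lia.
Qed.

Lemma stable_ordS s n (S : {set 'I_n}) (i : 'I_n) :
  1 < n -> 1 < s -> stable s S -> i \in S -> ordS i \notin S.
Proof.
move=> n1 s1 /stableP H iS; apply/negP => i'S.
have := H i (ordS i) iS i'S; have := H (ordS i) i i'S iS.
by rewrite val_ordS; have := ltn_ord i; case: eqP => ?; lia.
Qed.

(** * Rotation of the stable Kneser graph *)

Section Rotation.
Variables s m k : nat.
Hypothesis (s_gt1 : 1 < s) (k_gt0 : 0 < k) (n_gt : 2 * k < m.+1).
Hypothesis (n_ge : s * k <= m.+1).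
Let V := stable_kneser_vertex s m.+1 k.
Implicit Types x y z : V.

Let stableV x : stable s (val x). Proof. by case/andP: (valP x). Qed.
Let cardV x : #|val x| = k. Proof. by case/andP: (valP x) => /eqP. Qed.
Let ordSN x i : i \in val x -> ordS i \notin val x.
Proof. by apply: stable_ordS (stableV x); lia. Qed.

Lemma rotateP x : (#|@ordS _ @: val x| == k) && stable s (@ordS _ @: val x).
Proof.
by rewrite card_imset ?cardV ?eqxx ?stable_rotate //; exact: ordS_inj.
Qed.

Definition rotate x : V := Sub (@ordS _ @: val x) (rotateP x).

Lemma val_rotate x : val (rotate x) = @ordS _ @: val x.
Proof. exact: SubK. Qed.

Lemma mem_rotate x i : (ordS i \in val (rotate x)) = (i \in val x).
Proof. by rewrite val_rotate mem_imset //; exact: ordS_inj. Qed.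

Lemma rotate_inj : injective rotate.
Proof.
move=> x y E; apply/val_inj/setP => i.
by rewrite -mem_rotate E mem_rotate.
Qed.

Lemma stable_kneser_rotate x : stable_kneser s m.+1 k x (rotate x).
Proof.
rewrite /stable_kneser disjoint_sym; apply/pred0P => i /=; apply/negP => /andP[].
by case/imsetP => j jx ->; apply/negP/ordSN.
Qed.

Lemma iter_ordS (i : 'I_m.+1) r : iter r (@ordS _) i = (i + r) %% m.+1 :> nat.
Proof.
elim: r => [|r IH]; first by rewrite addn0 modn_small.
by rewrite iterS /= IH addnS -addn1 modnDml addn1.
Qed.

(** The summand [m.+1] prevents truncation when [j < i]. *)
Lemma iter_ordS_sub (i j : 'I_m.+1) : iter (j + m.+1 - i) (@ordS _) i = j.
Proof.
apply/val_inj; rewrite /= iter_ordS.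
have -> : i + (j + m.+1 - i) = j + m.+1 by have := ltn_ord i; lia.
by rewrite modnDr modn_small.
Qed.

(** If S + 2 = S, the union of S and S + 1 is closed under successor, hence is everything, and n is
    at most 2k, against [n_gt]. *)
Lemma rotate_rotate_neq x : rotate (rotate x) != x.
Proof.
apply/eqP => E.
have [i ix] : exists i, i \in val x.
  by apply/set0Pn; rewrite -card_gt0 cardV.
pose U := val x :|: @ordS _ @: val x.
have US j : j \in U -> ordS j \in U.
  rewrite !inE -val_rotate mem_rotate => /orP[->|]; first by rewrite orbT.
  by move=> jr; rewrite -[in X in X || _]E mem_rotate jr.
have UT : U = setT.
  apply/setP => j; rewrite [RHS]inE -(iter_ordS_sub i j).
  by elim: (_ - _) => [|r IH]; [rewrite inE ix | exact: US].
have := cardsU (val x) (@ordS _ @: val x); rewrite -/U UT cardsT card_ord.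
rewrite cardV card_imset ?cardV; last exact: ordS_inj.
lia.
Qed.

(** * Links between orbits *)

Definition advance (i : 'I_m.+1) (S : {set 'I_m.+1}) := ordS i |: (S :\ i).

Lemma imset_advance i S : @ordS _ @: advance i S = advance (ordS i) (@ordS _ @: S).
Proof.
rewrite /advance imsetU1; congr (_ |: _); apply/setP => j.
rewrite -[j]ord_predK !inE !mem_imset; try exact: ordS_inj.
by rewrite !inE (inj_eq (@ordS_inj _)).
Qed.

(* [x] and [y] are the [S] and [S'] of the introduction. *)
Definition half_link x y : bool :=
  (ord0 \in val x) && (val y == @ordS _ @: advance ord0 (val x)).
Definition link x y : bool := half_link x y || half_link y x.

Let ordSS0 : ordS (ordS ord0) != ord0 :> 'I_m.+1.
Proof. by rewrite -val_eqE /= !modn_small //; lia. Qed.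

(** Elements of S' other than 2 lie in S + 1, which misses S. If 2 were in S, advancing 0 would
    leave it in place, and S' would contain both 2 and 3. *)
Lemma half_link_adj x y : half_link x y -> stable_kneser s m.+1 k x y.
Proof.
move=> /andP[x0 /eqP Ey]; apply/pred0P => i /=; apply/negP => /andP[ix].
rewrite Ey => /imsetP[j]; rewrite !inE => /orP[/eqP ->|/andP[_ jx]] Ei; last first.
  by have := ordSN jx; rewrite -Ei ix.
have iA : i \in advance ord0 (val x) by rewrite !inE ix Ei ordSS0 orbT.
have iy : i \in val y by rewrite Ey Ei imset_f // !inE eqxx.
by have := ordSN iy; rewrite Ey imset_f.
Qed.

Lemma half_link_l x y z : half_link x y -> half_link x z -> y = z.
Proof.
by move=> /andP[_ /eqP Ey] /andP[_ /eqP Ez]; apply: val_inj; rewrite Ey Ez.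
Qed.

(** S is recovered from S': advancing 0 changes only the membership of 0 and 1, and S contains 0
    but, being stable, not 1. *)
Lemma half_link_r x y z : half_link x z -> half_link y z -> x = y.
Proof.
move=> /andP[x0 /eqP Ez] /andP[y0 /eqP]; rewrite Ez => /(imset_inj (@ordS_inj _)).
move=> /setP E; apply/val_inj/setP => i.
have [->|i0] := eqVneq i ord0; first by rewrite x0 y0.
have [->|i1] := eqVneq i (ordS ord0).
  by rewrite (negPf (ordSN x0)) (negPf (ordSN y0)).
by have := E i; rewrite !inE (negPf i0) (negPf i1).
Qed.

(** S' misses 0: its element 2 is not 0, and the others lie in S + 1, which is disjoint from S while
    0 is in S. *)
Lemma half_link_lr x y z : half_link x y -> half_link z x -> False.
Proof.
move=> /andP[x0 _] /andP[z0 /eqP Ex]; move: x0; rewrite Ex => /imsetP[j].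
rewrite !inE => /orP[/eqP -> /eqP|/andP[_ jz] E];
  first by rewrite eq_sym (negPf ordSS0).
by have := ordSN jz; rewrite -E z0.
Qed.

Lemma link_fun x y z : link x y -> link x z -> y = z.
Proof.
move=> /orP[xy|yx] /orP[xz|zx].
- exact: half_link_l xy xz.
- by case: (half_link_lr xy zx).
- by case: (half_link_lr xz yx).
- exact: half_link_r yx zx.
Qed.

Lemma stable_kneser_rotate2 x y :
  stable_kneser s m.+1 k (rotate x) (rotate y) = stable_kneser s m.+1 k x y.
Proof.
by rewrite /stable_kneser !val_rotate imset_disjoint //; exact: ordS_inj.
Qed.

Lemma stable_kneser_sym : symmetric (stable_kneser s m.+1 k).
Proof. by move=> x y; rewrite /stable_kneser disjoint_sym. Qed.

Lemma link_adj x y : link x y ->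
  stable_kneser s m.+1 k x y && stable_kneser s m.+1 k (rotate x) (rotate y).
Proof.
rewrite stable_kneser_rotate2 andbb => /orP[/half_link_adj //|/half_link_adj].
by rewrite stable_kneser_sym.
Qed.

(** * Packed vertices and connectedness of the orbits *)

Definition packed x : Prop := ord0 \in val x /\
  forall i, i \in val x -> i != ord0 -> exists2 j, j \in val x & i = j + s :> nat.

(** Descending from [i] in steps of [s] stays in [x] until 0 is reached, so a packed vertex is an
    initial segment of the multiples of [s]. *)
Lemma packed_dvdn x (i : 'I_m.+1) : packed x -> i \in val x ->
  s %| i /\ forall j : 'I_m.+1, j <= i -> s %| j -> j \in val x.
Proof.
move=> [x0 px]; have [r] := ubnP (i : nat); elim: r i => // r IH i lti ix.
have [i0|ni0] := eqVneq i ord0.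
  rewrite i0; split=> // j; rewrite leqn0 => /eqP j0 _.
  by rewrite (_ : j = ord0) //; apply: val_inj.
have [i' i'x Ei] := px i ix ni0.
have [|si' Hi'] := IH i' _ i'x; first by lia.
split=> [|j lej sj]; first by rewrite Ei dvdn_addl.
have [->//|nji] := eqVneq j i.
apply: Hi' => //; move: nji; rewrite -val_eqE /= => nji.
have ltji : j < i by rewrite ltn_neqAle nji.
(* Distinct multiples of [s] differ by at least [s], so [j] is at most [i']. *)
have : s %| i - j by rewrite dvdn_sub // Ei dvdn_addl.
by move=> /dvdn_leq; lia.
Qed.

(** Of two initial segments of the multiples of [s] one contains the other, and both have [k]
    elements. *)
Lemma packed_uniq x y : packed x -> packed y -> x = y.
Proof.
move=> px py; apply: val_inj.
have [sub|/subsetPn[a ax nay]] := boolP (val x \subset val y).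
  by apply/eqP; rewrite eqEcard sub !cardV leqnn.
apply/esym/eqP; rewrite eqEcard !cardV leqnn andbT; apply/subsetP => b b_y.
have [sa Ha] := packed_dvdn px ax; have [sb Hb] := packed_dvdn py b_y.
have [/Ha->//|/ltnW ab] := leqP b a.
by rewrite Hb in nay.
Qed.

Section Connected.
Variable W : pred V.
Hypothesis (W_rotate : forall x, W (rotate x) = W x).
Hypothesis (W_link : forall x y, link x y -> W x = W y).

(** Advancing commutes with rotation, so [i] may be rotated to 0, where [x] is linked to the
    rotation of [y]. *)
Lemma advance_connected i x y :
  i \in val x -> val y = advance i (val x) -> W x = W y.
Proof.
move: (iter_ordS_sub i ord0); move: (ord0 + m.+1 - i) => r.
elim: r i x y => [|r IH] i x y Ei ix Ey; rewrite ?iterSr /= in Ei.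
  rewrite -(W_rotate y); apply: W_link; rewrite /link /half_link -Ei ix.
  by rewrite val_rotate Ey eqxx.
rewrite -(W_rotate x) -[RHS]W_rotate; apply: (IH (ordS i)).
- exact: Ei.
- by rewrite mem_rotate.
- by rewrite !val_rotate Ey imset_advance.
Qed.

Definition weight x := \sum_(i in val x) (i : nat).

(** As 0 is not in [x], no element of [y] wraps around, and the sum grows by exactly [k]. *)
Lemma weight_rotate x y : rotate y = x -> ord0 \notin val x -> weight y < weight x.
Proof.
move=> <- x0; rewrite /weight val_rotate big_imset /=; last first.
  by move=> i j _ _; exact: ordS_inj.
have -> : \sum_(i in val y) (ordS i : nat) = \sum_(i in val y) (i + 1).
  apply: eq_bigr => i iy; rewrite val_ordS addn1; case: eqP => // E.
  case/negP: x0; suff <- : ordS i = ord0 by rewrite mem_rotate.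
  by apply: val_inj; rewrite [LHS]val_ordS E eqxx.
by rewrite big_split /= sum1_card cardV -addn1 leq_add2l.
Qed.

(** Elements below [i] are more than [s] away, so there is room for one step down. Across the
    wraparound nothing gets too close, since 0 in [x] already forces [b + s <= n] for every [b]
    above [i]. *)
Lemma stable_retreat x i p : i \in val x -> ordS p = i -> i != ord0 ->
  ord0 \in val x -> (forall j, j \in val x -> i != j + s :> nat) ->
  stable s (p |: (val x :\ i)).
Proof.
move=> ix Ep i0 x0 ni; have /stableP H := stableV x.
have pi : i = p.+1 :> nat.
  have := val_ordS p; rewrite Ep; case: eqP => // _ Ei.
  by case/eqP: i0; apply: val_inj.
apply/stableP => a b; rewrite !inE -!val_eqE /=.
move=> /orP[/eqP Ea|/andP[nai ax]] /orP[/eqP Eb|/andP[nbi bx]] ab.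
- lia.
- have := H i b ix bx; have := H ord0 b x0 bx; move: nbi ab => /=; lia.
- have := H a i ax ix; have := ni a ax; move: nai ab => /=; lia.
- exact: H.
Qed.

(** Take a vertex of least weight in [W]. Were 0 missing, rotating backwards would lower the weight;
    were [i - s] missing for some nonzero [i], moving [i] down by one would. *)
Lemma exists_packed : (exists x, W x) -> exists2 x, W x & packed x.
Proof.
case=> x0 W0; case: (arg_minnP weight W0) => x Wx minx; exists x => //.
have x00 : ord0 \in val x.
  apply/negPn/negP => nx0; have Ey := f_finv rotate_inj x.
  have := minx (finv rotate x); rewrite -W_rotate Ey => /(_ Wx).
  by rewrite leqNgt weight_rotate.
split=> // i ix i0; apply/'exists_in_eqP.
apply: contraT => /exists_inPn noj.
have [p Ep] : exists p, ordS p = i by exists (ord_pred i); rewrite ord_predK.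
have px : p \notin val x by apply: contraL ix => /ordSN; rewrite Ep.
have T : (#|p |: (val x :\ i)| == k) && stable s (p |: (val x :\ i)).
  rewrite cardsU1 !inE (negPf px) andbF.
  have := cardV x; rewrite (cardsD1 i) ix => ->; rewrite eqxx /=.
  by apply: stable_retreat.
pose y : V := Sub (p |: (val x :\ i)) T.
have Vy : val y = p |: (val x :\ i) by exact: SubK.
have np : p \notin val x :\ i by rewrite !inE (negPf px) andbF.
have Wy : W y.
  (* [x] arises from [y] by advancing [p], so the lemma is used from [y] to [x]. *)
  rewrite (advance_connected (i := p) (y := x)) //; first by rewrite Vy !inE eqxx.
  by rewrite Vy /advance Ep setU1K // setD1K.
have /= := minx y Wy; rewrite /weight Vy (big_setU1 _ np) /= (big_setD1 i ix) /=.
have := val_ordS p; rewrite Ep leq_add2r; case: eqP => [_ Ei|_ ->].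
  by case/eqP: i0; apply: val_inj.
by rewrite ltnn.
Qed.

End Connected.

(** Otherwise [W] and its complement, both closed, would each contain the unique packed vertex. *)
Lemma link_connected (W : pred V) : (exists x, W x) ->
  (forall x, W (rotate x) = W x) -> (forall x y, link x y -> W x = W y) ->
  forall x, W x.
Proof.
move=> exW Wr Wl x; apply/negPn/negP => nWx.
have [y Wy py] := exists_packed Wr Wl exW.
have [|||z nWz pz] := @exists_packed (fun x => ~~ W x).
- by move=> z; rewrite Wr.
- by move=> z t /Wl ->.
- by exists x.
by rewrite -(packed_uniq py pz) Wy in nWz.
Qed.

(** By [n_ge] the first [k] multiples of [s] fit, including the gap from the last one round to 0. *)
Lemma stable_kneser_inhabited : V.
Proof.
pose F (j : 'I_k) : 'I_m.+1 := inord (s * j).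
have valF j : F j = s * j :> nat.
  rewrite inordK // (leq_trans _ n_ge) // ltn_pmul2l //; lia.
have F_inj : injective F.
  move=> a b /(congr1 val) /=; rewrite !valF => /eqP.
  by rewrite eqn_pmul2l; [move/eqP/val_inj | lia].
have P : (#|F @: 'I_k| == k) && stable s (F @: 'I_k).
  rewrite card_imset // card_ord eqxx /=.
  apply/stableP => _ _ /imsetP[a _ ->] /imsetP[b _ ->]; rewrite !valF => ab.
  have ltab : a < b by move: ab; rewrite ltn_pmul2l //; lia.
  rewrite -!mulnSr; split; first by rewrite leq_mul2l ltab orbT.
  have : s * b.+1 <= s * k by rewrite leq_mul2l ltn_ord orbT.
  lia.
exact: (Sub (F @: 'I_k) P).
Qed.

Lemma stable_kneser_hamiltonian : hamiltonian (stable_kneser s m.+1 k).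
Proof.
apply: (hamiltonian_of_rotation rotate_inj stable_kneser_sym stable_kneser_rotate
  rotate_rotate_neq _ link_fun link_adj link_connected stable_kneser_inhabited).
by move=> x y; rewrite /link orbC.
Qed.

End Rotation.

(** * Necessity of the bounds on n *)

Lemma disjoint_card n (S T : {set 'I_n}) : [disjoint S & T] -> #|S| + #|T| <= n.
Proof.
by rewrite -leq_card_setU => /eqP <-; rewrite -[leqRHS]card_ord max_card.
Qed.

(* The translates [S], [S + 1], ..., [S + s - 1] are pairwise disjoint. *)
Lemma mul_card_stable s n (S : {set 'I_n}) :
  1 < #|S| -> stable s S -> s * #|S| <= n.
Proof.
move=> /card_gt1P[a [b [aS bS nab]]] /stableP H.
have n0 : 0 < n by have := ltn_ord a; lia.
pose F (t : 'I_n * 'I_s) : 'I_n := Ordinal (ltn_pmod (t.1 + t.2) n0).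
(* Two elements cut the cycle into two arcs of length at least [s]. Hence the sums in [F] stay below
   2n, and reduction modulo n subtracts n at most once. *)
have sn : s + s <= n.
  have := H a b aS bS; have := H b a bS aS; move: nab; rewrite -val_eqE /=.
  lia.
have : {in setX S [set: 'I_s] &, injective F}.
  move=> [i c] [j d]; rewrite !in_setX /= !in_setT !andbT => iS jS [E].
  have ltc := ltn_ord c; have ltd := ltn_ord d.
  have [Eij|nij] := eqVneq i j.
    move: E; rewrite Eij => /eqP; rewrite eqn_modDl !modn_small; try lia.
    by move=> /eqP/val_inj ->.
  have Hij := H i j iS jS; have Hji := H j i jS iS.
  move: nij; rewrite -val_eqE /= => nij.
  have mE u : u < n + n -> u %% n = if u < n then u else u - n.
    case: (ltnP u n) => [un _|nu un]; first by rewrite modn_small.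
    by rewrite -{1}(subnK nu) modnDr modn_small //; lia.
  have lti := ltn_ord i; have ltj := ltn_ord j.
  move: E; rewrite !mE; try lia.
  by case: (ltnP (i + c) n) => ?; case: (ltnP (j + d) n) => ? ?; exfalso; lia.
by move=> /leq_card_in; rewrite cardsX cardsT !card_ord mulnC.
Qed.

(** Covers [k = 1], where stability is vacuous and [mul_card_stable] does not apply. *)
Lemma card_vertex1 s n : #|stable_kneser_vertex s n 1| <= n.
Proof.
rewrite -[leqRHS]bin1 -[in leqRHS](card_ord n) -card_draws card_sig cardsE.
by apply/subset_leq_card/subsetP => S; rewrite !inE => /andP[].
Qed.

(** For [k = 1] the graph is complete on n vertices whatever [s] is, hence Hamiltonian also when 3
    <= n < s; the condition on [k = 1] excludes exactly this range. *)
Theorem theorem1 :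
  (forall n k s : nat, 1 <= n -> 1 <= k -> 3 <= s ->
     (k = 1 -> 3 <= n -> s <= n) ->
     (hamiltonian (stable_kneser s n k) <-> s * k <= n))
  /\
  (forall n k : nat, 1 <= n -> 1 <= k ->
     (hamiltonian (stable_kneser 2 n k) <-> 2 * k + 1 <= n)).
Proof.
split=> [n k s n0 k0 s3 k1|n k n0 k0]; split.
- move=> [c [c3 _ Uc _]].
  have V3 : 3 <= #|stable_kneser_vertex s n k|.
    by rewrite (leq_trans c3) // -(card_uniqP Uc) max_card.
  have [Ek|kn1] := eqVneq k 1.
    by rewrite Ek muln1 k1 // (leq_trans V3) // Ek card_vertex1.
  have /card_gt0P[x _] : 0 < #|stable_kneser_vertex s n k| by exact: leq_trans V3.
  have /andP[/eqP cx sx] := valP x.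
  by rewrite -cx mul_card_stable // cx; lia.
- case: n n0 {k1} => // m _ skn; apply: stable_kneser_hamiltonian => //; nia.
- move=> [[|x [|y [|z c]]] [//= _ /and3P[xy yz _]]]; rewrite !inE.
  move=> /andP[/norP[_ /norP[nxz _]] _] _.
  have cV (t : stable_kneser_vertex 2 n k) : #|val t| = k.
    by case/andP: (valP t) => /eqP.
  have := disjoint_card xy; rewrite !cV => le.
  rewrite addn1 ltn_neqAle mul2n -addnn le andbT.
  (* If n were 2k, the neighbours [x] and [z] of [y] on the cycle would both be the complement of
     [y]. *)
  apply: contraNneq nxz => En; apply/eqP/val_inj.
  have compl (t : stable_kneser_vertex 2 n k) :
      [disjoint val t & val y] -> val t = ~: val y.
    move=> ty; apply/eqP; rewrite eqEcard -disjoints_subset ty andTb.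
    by have := cardsC (val y); rewrite !cV card_ord; lia.
  by rewrite (compl x xy) (compl z) // disjoint_sym.
- case: n n0 => // m _ kn; apply: stable_kneser_hamiltonian => //; lia.
Qed.
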